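(* Let $V_T$ be a set of terminals, $V_N=\{0,1,\dots,n\}$ a finite set of nonterminals, $\Delta$ the set of PEG expressions over $V_T,V_N$, and $P_{exp}:V_N\to\Delta$. Let $\mathbb{F}=\{P\in\mathbb{C}: P=r_0^P\}$. Then for every $P\in\mathbb{F}$ and every $A\in V_N$, $P=\rho(A,P)$.
   Context: PEG expressions $\Delta$ are generated by: $\epsilon$, $[\cdot]$, $[a]$ ($a\in V_T$), $A$ ($A\in V_N$), $e_1;e_2$, $e_1/e_2$, $e*$, $!e$. A property map is $P:V_N\to\{\mathrm{true},\mathrm{false}\}^3$, $\mathbb{P}$ the set of all of them; $P\le P'$ iff for all $A$ and $i\in\{1,2,3\}$, $P(A)_i\Rightarrow P'(A)_i$. Define $g:\Delta\times\mathbb{P}\to\{\mathrm{true},\mathrm{false}\}^3$, $g(e,P)=(\bot(e),z(e),c(e))$, recursively: $g(\epsilon,P)=(\mathrm{false},\mathrm{true},\mathrm{false})$; $g([\cdot],P)=g([a],P)=(\mathrm{true},\mathrm{false},\mathrm{true})$; $g(A,P)=P(A)$; for $e_1;e_2$: $\bot=\bot(e_1)\vee((z(e_1)\vee c(e_1))\wedge\bot(e_2))$, $z=z(e_1)\wedge z(e_2)$, $c=(c(e_1)\wedge(z(e_2)\vee c(e_2)))\vee(z(e_1)\wedge c(e_2))$; for $e_1/e_2$: $\bot=\bot(e_1)\wedge\bot(e_2)$, $z=z(e_1)\vee(\bot(e_1)\wedge z(e_2))$, $c=c(e_1)\vee(\bot(e_1)\wedge c(e_2))$; for $e*$: $(\mathrm{false},\bot(e),c(e))$;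 for $!e$: $(z(e)\vee c(e),\bot(e),\mathrm{false})$. Define $\rho(A,P)\in\mathbb{P}$ by $\rho(A,P)(A)=g(P_{exp}(A),P)$ and $\rho(A,P)(B)=P(B)$ for $B\ne A$. Coherent maps: $\mathbb{C}=\{P\in\mathbb{P}:\forall A\in V_N,\ P\le\rho(A,P)\}$. For $P\in\mathbb{P}$ and $A\in\{0,\dots,n\}$ define $r_n^P=\rho(n,P)$ and, for $A<n$, $r_A^P=r_{A+1}^{\rho(A,P)}$. *)

(* Defs.v *)
From mathcomp Require Import all_boot.

Set Implicit Arguments.
Unset Strict Implicit.
Unset Printing Implicit Defensive.

Inductive peg (VT VN : Type) : Type :=
| PEG_Eps
| PEG_Any
| PEG_Term of VT
| PEG_NonTerm of VN
| PEG_Seq of peg VT VN & peg VT VN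
| PEG_Choice of peg VT VN & peg VT VN
| PEG_Star of peg VT VN
| PEG_Not of peg VT VN.

Arguments PEG_Eps {VT VN}.
Arguments PEG_Any {VT VN}.
Arguments PEG_Term {VT VN} _.
Arguments PEG_NonTerm {VT VN} _.

(* The triple (bot, z, c): bot = may fail, z = may succeed consuming nothing,
   c = may succeed consuming input. *)
Definition props : Type := (bool * bool * bool)%type.
Definition p_bot (t : props) : bool := t.1.1.
Definition p_z (t : props) : bool := t.1.2.
Definition p_c (t : props) : bool := t.2.

Definition propmap (n : nat) : Type := {ffun 'I_n.+1 -> props}.

Definition propmap_le (n : nat) (P P' : propmap n) : Prop :=
  forall A : 'I_n.+1,
    [/\ p_bot (P A) -> p_bot (P' A),
        p_z (P A) -> p_z (P' A) &
        p_c (P A) -> p_c (P' A)].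

Fixpoint g (VT : Type) (n : nat) (e : peg VT 'I_n.+1) (P : propmap n) : props :=
  match e with
  | PEG_Eps => (false, true, false)
  | PEG_Any => (true, false, true)
  | PEG_Term _ => (true, false, true)
  | PEG_NonTerm A => P A
  | PEG_Seq e1 e2 =>
      let t1 := g e1 P in let t2 := g e2 P in
      (p_bot t1 || ((p_z t1 || p_c t1) && p_bot t2),
       p_z t1 && p_z t2,
       (p_c t1 && (p_z t2 || p_c t2)) || (p_z t1 && p_c t2))
  | PEG_Choice e1 e2 =>
      let t1 := g e1 P in let t2 := g e2 P in
      (p_bot t1 && p_bot t2,
       p_z t1 || (p_bot t1 && p_z t2),
       p_c t1 || (p_bot t1 && p_c t2))
  | PEG_Star e1 => let t := g e1 P in (false, p_bot t, p_c t)
  | PEG_Not e1 => let t := g e1 P in (p_z t || p_c t, p_bot t, false)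
  end.

Definition rho (VT : Type) (n : nat) (Pexp : 'I_n.+1 -> peg VT 'I_n.+1)
    (A : 'I_n.+1) (P : propmap n) : propmap n :=
  [ffun B => if B == A then g (Pexp A) P else P B].

Definition coherent (VT : Type) (n : nat) (Pexp : 'I_n.+1 -> peg VT 'I_n.+1)
    (P : propmap n) : Prop :=
  forall A : 'I_n.+1, propmap_le P (rho Pexp A P).

(* [r_rec Pexp k P] is r_(n-k)^P: the recursion on A going up to n is run as
   structural recursion on k = n - A. The defining equations of r are
   [r_max] and [r_lt] below. *)
Fixpoint r_rec (VT : Type) (n : nat) (Pexp : 'I_n.+1 -> peg VT 'I_n.+1)
    (k : nat) (P : propmap n) : propmap n :=
  match k with
  | 0 => rho Pexp ord_max P
  | k'.+1 => r_rec Pexp k' (rho Pexp (inord (n - k)) P)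
  end.

Definition r (VT : Type) (n : nat) (Pexp : 'I_n.+1 -> peg VT 'I_n.+1)
    (A : 'I_n.+1) (P : propmap n) : propmap n :=
  r_rec Pexp (n - A) P.

Lemma r_max (VT : Type) (n : nat) (Pexp : 'I_n.+1 -> peg VT 'I_n.+1)
    (P : propmap n) :
  r Pexp ord_max P = rho Pexp ord_max P.
Proof. by rewrite /r subnn. Qed.

Lemma r_lt (VT : Type) (n : nat) (Pexp : 'I_n.+1 -> peg VT 'I_n.+1)
    (A : 'I_n.+1) (P : propmap n) :
  A < n -> r Pexp A P = r Pexp (inord A.+1) (rho Pexp A P).
Proof.
move=> ltAn; rewrite /r inordK // -[n - A]prednK ?subn_gt0 //= -subnS.
congr (r_rec _ _ (rho _ _ _)); apply: val_inj.
by rewrite /= -subSn // subSS subKn ?inordK // ltnW.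
Qed.

Definition fixed_coherent (VT : Type) (n : nat)
    (Pexp : 'I_n.+1 -> peg VT 'I_n.+1) (P : propmap n) : Prop :=
  coherent Pexp P /\ P = r Pexp ord0 P.

(* Main.v *)
(* Every operation in [g] is monotone in the property map, even [!], whose
   definition involves no negation. Hence [rho A] is monotone and preserves
   coherence, so the successive updates composing [r_0] form an increasing
   chain starting at [P]. If the chain ends at [P], it is constant, so that
   each update fixes [P]. *)
Require Import Defs.
From mathcomp Require Import all_boot.

Set Implicit Arguments.
Unset Strict Implicit.
Unset Printing Implicit Defensive.

(** This is the body of [propmap_le] at a single nonterminal, so the order on maps is convertible to
    this order taken pointwise. *)
Definition props_le (t t' : props) : Prop :=
  [/\ p_bot t -> p_bot t', p_z t -> p_z t' & p_c t -> p_c t'].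

Lemma props_le_refl (t : props) : props_le t t.
Proof. by []. Qed.

Lemma props_le_trans (t1 t2 t3 : props) :
  props_le t1 t2 -> props_le t2 t3 -> props_le t1 t3.
Proof. by case=> b12 z12 c12 [b23 z23 c23]; split; auto. Qed.

Lemma props_le_anti (t1 t2 : props) :
  props_le t1 t2 -> props_le t2 t1 -> t1 = t2.
Proof.
move: t1 t2 => [[b1 z1] c1] [[b2 z2] c2] [b12 z12 c12] [b21 z21 c21].
by congr (_, _, _); apply/idP/idP.
Qed.

Lemma propmap_le_trans (n : nat) (P1 P2 P3 : propmap n) :
  propmap_le P1 P2 -> propmap_le P2 P3 -> propmap_le P1 P3.
Proof. by move=> le12 le23 A; apply: props_le_trans (le12 A) (le23 A). Qed.

Lemma propmap_le_anti (n : nat) (P1 P2 : propmap n) :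
  propmap_le P1 P2 -> propmap_le P2 P1 -> P1 = P2.
Proof.
by move=> le12 le21; apply/ffunP => A; apply: props_le_anti (le12 A) (le21 A).
Qed.

Lemma orb_monotone (a a' b b' : bool) :
  (a -> a') -> (b -> b') -> a || b -> a' || b'.
Proof. by move=> A B /orP[/A|/B] ->; rewrite ?orbT. Qed.

Lemma andb_monotone (a a' b b' : bool) :
  (a -> a') -> (b -> b') -> a && b -> a' && b'.
Proof. by move=> A B /andP[/A -> /B ->]. Qed.

Lemma g_monotone (VT : Type) (n : nat) (e : peg VT 'I_n.+1) (P Q : propmap n) :
  propmap_le P Q -> props_le (g e P) (g e Q).
Proof.
move=> lePQ; elim: e => [||a|A|e1 IH1 e2 IH2|e1 IH1 e2 IH2|e IH|e IH] /=;
  try exact: props_le_refl.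
- exact: lePQ.
- case: IH1 IH2 => B1 Z1 C1 [B2 Z2 C2].
  by split; do ?[apply: orb_monotone | apply: andb_monotone].
- case: IH1 IH2 => B1 Z1 C1 [B2 Z2 C2].
  by split; do ?[apply: orb_monotone | apply: andb_monotone].
- by case: IH => B Z C; split.
- by case: IH => B Z C; split=> //; apply: orb_monotone.
Qed.

Section Coherence.

Variables (VT : Type) (n : nat) (Pexp : 'I_n.+1 -> peg VT 'I_n.+1).

(** Coherence at [A] gives [P] below [rho Pexp A P], so by monotonicity [g] can only grow when the
    map is updated. *)
Lemma coherent_rho (A : 'I_n.+1) (P : propmap n) :
  coherent Pexp P -> coherent Pexp (rho Pexp A P).
Proof.
move=> cohP B C; set Q := rho Pexp A P.
rewrite -/(props_le _ _) [rho Pexp B Q C]ffunE.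
case: (C =P B) => [->|_]; last exact: props_le_refl.
(* The value computed from the old map separates the two sides: [Q B] equals it if [B] is [A], and
   otherwise is [P B], which lies below it by coherence of [P]. *)
apply: (@props_le_trans _ (g (Pexp B) P)); last exact: g_monotone (cohP A).
rewrite /Q ffunE; case: (B =P A) => [->|_]; first exact: props_le_refl.
by have := cohP B B; rewrite [rho _ _ _ _]ffunE eqxx.
Qed.

Lemma coherent_le_r_rec (k : nat) (P : propmap n) :
  coherent Pexp P -> propmap_le P (r_rec Pexp k P).
Proof.
elim: k P => [|k IHk] P cohP /=; first exact: cohP.
exact: propmap_le_trans (cohP _) (IHk _ (coherent_rho _ cohP)).
Qed.

Lemma r_rec_fixed (k : nat) (P : propmap n) :
  coherent Pexp P -> r_rec Pexp k P = P ->
  forall j, j <= k -> rho Pexp (inord (n - j)) P = P.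
Proof.
move=> cohP; elim: k => [|k IHk] /= fixP j.
  (* The last update is at [ord_max], which has the same value as [inord n]. *)
  rewrite leqn0 => /eqP ->; rewrite subn0 -[RHS]fixP.
  by congr rho; apply: val_inj; rewrite /= inordK.
(* The first update is squeezed between [P] and the end of the chain, which is again [P]. *)
have fix_step : rho Pexp (inord (n - k.+1)) P = P.
  apply: propmap_le_anti (cohP _).
  by rewrite -[X in propmap_le _ X]fixP; apply/coherent_le_r_rec/coherent_rho.
rewrite leq_eqVlt => /predU1P[-> //|].
(* As the first update fixes [P], the shorter chain also starts and ends at [P]. *)
by apply: IHk; rewrite -[in LHS]fix_step.
Qed.

End Coherence.

Theorem theorem3p3 (VT : Type) (n : nat)
    (Pexp : 'I_n.+1 -> peg VT 'I_n.+1) (P : propmap n)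
    (hP : fixed_coherent Pexp P) (A : 'I_n.+1) :
  P = rho Pexp A P.
Proof.
case: hP => cohP fixP.
rewrite /r subn0 in fixP.
(* Nonterminal [A] is updated at index [j = n - A], since [n - (n - A) = A]. *)
have := r_rec_fixed cohP (esym fixP) (leq_subr A n).
by rewrite subKn ?inord_val // leq_ord.
Qed.
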